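(* Let $b>-1$, $\eta>0$, and let $\beta_n,\gamma_n$ be the recursion coefficients of the generalized Charlier polynomials. For $n\in\mathbb N_0$ they satisfy the Laguerre--Freud relations $$\beta_{n+1}=\frac{\eta(n+1)}{\gamma_{n+1}}-\beta_n+n-b,$$ $$\gamma_{n+1}=\eta-\gamma_n-\beta_n^2-b\beta_n+\frac{\gamma_{n-1}\gamma_n}{\eta}+\frac{\eta n^2}{\gamma_n},\qquad \gamma_{-1}=\gamma_0=0,$$ where for $n=0$ the term $\frac{\eta n^2}{\gamma_n}$ is understood to be $0$. Moreover, for $n\in\mathbb N=\{1,2,\dots\}$ the coefficient $p^1_n$ of $z^{n-1}$ in $P_n(z)$ is $$p^1_n=\frac{n(n+1)}{2}-n\beta_n-\frac{\gamma_n\gamma_{n+1}}{\eta}.$$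
   Context: The generalized Charlier weight with parameters $b>-1$, $\eta>0$ is $w(k)=\frac{\eta^k}{(b+1)_k\,k!}$, $k\in\mathbb N_0=\{0,1,2,\dots\}$, where $(x)_k=x(x+1)\cdots(x+k-1)$. The generalized Charlier polynomials are the monic polynomials $P_n(z)=z^n+p^1_nz^{n-1}+\cdots$ with $\sum_{k\ge0}P_n(k)P_m(k)w(k)=\delta_{n,m}H_n$; their recursion coefficients are defined by $zP_n(z)=P_{n+1}(z)+\beta_nP_n(z)+\gamma_nP_{n-1}(z)$, $P_{-1}=0$, $P_0=1$. *)

(* Defs.v *)
From HB Require Import structures.
From mathcomp Require Import all_boot all_order all_algebra.
From mathcomp Require Import all_classical all_reals all_analysis.

Set Implicit Arguments.
Unset Strict Implicit.
Unset Printing Implicit Defensive.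

Import Order.TTheory GRing.Theory Num.Theory.
Import numFieldNormedType.Exports.

Local Open Scope classical_set_scope.
Local Open Scope ring_scope.

Definition pochhammer (R : realType) (x : R) (k : nat) : R :=
  \prod_(i < k) (x + i%:R).

Definition charlier_weight (R : realType) (b eta : R) (k : nat) : R :=
  eta ^+ k / (pochhammer (b + 1) k * k`!%:R).

(* The convergence of every orthogonality series is part of the predicate. *)
Definition generalized_charlier (R : realType) (b eta : R)
    (P : nat -> {poly R}) : Prop :=
  (forall n, P n \is monic /\ size (P n) = n.+1) /\
  exists H : nat -> R, forall n m : nat,
    series (fun k : nat =>
      (P n).[k%:R] * (P m).[k%:R] * charlier_weight b eta k) @ \oo
    --> (if n == m then H n else 0).

(* [term_before u n] is u_{n-1}, with the convention u_{-1} = 0. *)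
Definition term_before (V : nmodType) (u : nat -> V) (n : nat) : V :=
  if n is m.+1 then u m else 0.

(* At n = 0 the recurrence does not determine gamma_0, because P_{-1} = 0;
   its value is fixed by convention. *)
Definition recursion_coefficients (R : realType) (P : nat -> {poly R})
    (beta gamma : nat -> R) : Prop :=
  gamma 0%N = 0 /\
  forall n : nat,
    'X * P n = P n.+1 + beta n *: P n + gamma n *: term_before P n.

(* Main.v *)
(** Let [L f] be the sum over [k] of [f(k) w(k)]. The weight satisfies
    [(k+1) (k+1+b) w(k+1) = eta w(k)], so with [theta = X (X + b)] one has
    [L (theta f) = eta L (f(X+1))], that is
    [L (theta P_n(X) P_m(X-1)) = eta L (P_n(X+1) P_m(X))].
    As [theta] has degree 2 the left-hand side vanishes for [m < n - 2], so
    only three terms survive in the expansions of [P_n(X+1)] and [P_m(X-1)].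
    The case [m = n - 2] shows that the coefficient of [P_{n-2}] in [P_n(X+1)]
    is [gamma_n gamma_{n-1} / eta], which gives the subleading coefficient of
    [P_n]; [m = n - 1] gives the relation for [beta], and [m = n] the relation
    for [gamma]. *)

Require Import Defs.
From HB Require Import structures.
From mathcomp Require Import all_boot all_order all_algebra.
From mathcomp Require Import all_classical all_reals all_analysis.
From mathcomp Require Import ring.

Set Implicit Arguments.
Unset Strict Implicit.
Unset Printing Implicit Defensive.

Import Order.TTheory GRing.Theory Num.Theory.
Import numFieldNormedType.Exports.
Local Open Scope classical_set_scope.
Local Open Scope ring_scope.

(** Subtracting the multiple of [P m] by the top coefficient of [q] lowers the size. The predicate
    [K] is abstract because both convergence of series and vanishing of a functional are propagated
    this way. *)
Lemma monic_span_ind (R : nzRingType) (P : nat -> {poly R}) (K : {poly R} -> Prop)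
    (m : nat) :
  (forall n, P n \is monic /\ size (P n) = n.+1) ->
  K 0 -> (forall a p q, K p -> K q -> K (a *: p + q)) ->
  (forall i, (i < m)%N -> K (P i)) -> forall q : {poly R}, (size q <= m)%N -> K q.
Proof.
move=> hP K0 Klin; elim: m => [|m IHm] KP q sq.
  by move: sq; rewrite leqn0 size_poly_eq0 => /eqP ->.
have [Pm_monic Pm_size] := hP m.
have -> : q = q`_m *: P m + (q - q`_m *: P m) by rewrite addrC subrK.
apply: Klin; first exact: KP.
apply: IHm => [i im|]; first by apply: KP; rewrite ltnS ltnW.
apply/leq_sizeP => j; rewrite leq_eqVlt => /predU1P[<-|mj].
  have := monicP Pm_monic; rewrite lead_coefE Pm_size /= => lc.
  by rewrite coefB coefZ lc mulr1 subrr.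
rewrite coefB coefZ (nth_default _ (leq_trans sq mj)).
by rewrite [(P m)`_j]nth_default ?Pm_size ?mulr0 ?subrr.
Qed.

Lemma coef_comp_XaddC (R : comNzRingType) (p : {poly R}) (s : R) (k : nat) :
  (p \Po ('X + s%:P))`_k = \sum_(i < size p) p`_i * (s ^+ (i - k) *+ 'C(i, k)).
Proof.
rewrite coef_comp_poly; apply: eq_bigr => i _; congr (_ * _).
rewrite addrC exprDn coef_sum.
under eq_bigr do rewrite -polyC_exp coefMn coefCM coefXn.
have [ki|ik] := ltnP k i.+1.
  rewrite (bigD1 (Ordinal ki)) //= eqxx mulr1 big1 ?addr0 // => j.
  by rewrite -val_eqE /= eq_sym => /negPf ->; rewrite mulr0 mul0rn.
rewrite bin_small // mulr0n big1 // => j _.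
by rewrite gtn_eqF ?mulr0 ?mul0rn // (leq_trans _ ik).
Qed.

(** Coefficients in degrees n, n-1 and n-2 are compared. In degree n-2 the shift of [P n]
    contributes its leading and subleading terms, and s n P_{n-1} takes away its own subleading one.
    For n < 2 the truncated indices do no harm: the polynomial they multiply is 0. *)
Lemma size_shift_expansion (R : comNzRingType) (P : nat -> {poly R}) (s : R) (n : nat) :
  (forall n, P n \is monic /\ size (P n) = n.+1) ->
  (size ((P n \Po ('X + s%:P) -
     (P n + (s * n%:R) *: term_before P n +
      (s ^+ 2 * 'C(n, 2)%:R
       + s * (n.-1%:R * (P n)`_n.-1 - n%:R * (P n.-1)`_n.-2))
        *: term_before (term_before P) n))%R : {poly R}) <= n.-2)%N.
Proof.
move=> hP.
have Plead m : (P m)`_m = 1.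
  by have [/monicP + sm] := hP m; rewrite lead_coefE sm.
have Pbig m j : (m < j)%N -> (P m)`_j = 0.
  by have [_ sm] := hP m => mj; rewrite nth_default ?sm.
apply/leq_sizeP => j.
rewrite !coefB !coefD !coefZ coef_comp_XaddC.
have [_ ->] := hP n.
case: n => [|[|m]] /=.
- rewrite big_ord_recr big_ord0 /= coef0 !mulr0 !addr0 add0r Plead mul1r sub0n.
  by case: j => [|j] _; rewrite ?bin0 ?Plead ?subrr // Pbig // bin_small // mulr0n subrr.
- rewrite !big_ord_recr big_ord0 /= !Plead !coef0 !mulr0 !addr0 add0r.
  case: j => [|[|j]] _ /=.
  + by rewrite !bin0 Plead; ring.
  + by rewrite bin0n !bin1 /= Plead (Pbig 0%N) // subnn; ring.
  + by rewrite !bin_small ?mulr0n ?(Pbig _ j.+2) //; ring.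
- move=> mj; rewrite !big_ord_recr /= big1 => [|i _]; last first.
    by rewrite bin_small ?mulr0n ?mulr0 // (leq_trans _ mj).
  rewrite !Plead.
  move: mj; rewrite leq_eqVlt => /predU1P[<-|].
    have binC2 : 'C(m.+2, m) = 'C(m.+2, 2) by rewrite -[RHS]bin_sub // subn2.
    have -> : (m.+2 - m = 2)%N by rewrite subSn // subSnn.
    rewrite binn subnn subSnn binSn binC2 Plead; ring.
  rewrite leq_eqVlt => /predU1P[<-|].
    rewrite bin_small // binn subnn subSnn binSn Plead (Pbig m) //; ring.
  rewrite leq_eqVlt => /predU1P[<-|mj].
    rewrite (bin_small (leqnSn m.+1)) (bin_small (ltnSn m.+1)) binn subnn Plead.
    by rewrite (Pbig m.+1) // (Pbig m) //; ring.
  have [m1j m2j] : (m.+1 < j)%N /\ (m < j)%N by rewrite !(ltn_trans _ mj).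
  rewrite !(Pbig _ j) // (bin_small mj) (bin_small m1j) (bin_small m2j) !mulr0n; ring.
Qed.

(** * The weight and its discrete Pearson equation *)

Lemma charlier_weight_gt0 (R : realType) (b eta : R) (k : nat) :
  -1 < b -> 0 < eta -> 0 < charlier_weight b eta k.
Proof.
move=> hb heta; rewrite /charlier_weight /pochhammer divr_gt0 ?exprn_gt0 //.
rewrite mulr_gt0 ?ltr0n ?fact_gt0 // prodr_gt0 // => i _.
by rewrite ltr_wpDr // -ltrBlDr sub0r.
Qed.

Lemma charlier_weightS (R : realType) (b eta : R) (k : nat) : -1 < b ->
  k.+1%:R * (k.+1%:R + b) * charlier_weight b eta k.+1
    = eta * charlier_weight b eta k.
Proof.
move=> hb; rewrite /charlier_weight /pochhammer big_ord_recr /= factS natrM exprS.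
have b1_gt0 i : 0 < b + 1 + i%:R :> R by rewrite ltr_wpDr // -ltrBlDr sub0r.
have b1k := lt0r_neq0 (b1_gt0 k).
have prod_neq0 : \prod_(i < k) (b + 1 + i%:R) != 0 :> R.
  by apply/lt0r_neq0/prodr_gt0 => i _.
have kf_neq0 : k`!%:R != 0 :> R by rewrite pnatr_eq0 -lt0n fact_gt0.
have kS_neq0 : 1 + k%:R != 0 :> R by rewrite nat1r pnatr_eq0.
field.
by apply/and4P.
Qed.

Definition charlier_series (R : realType) (b eta : R) (p : {poly R}) : R ^nat :=
  series (fun k => p.[k%:R] * charlier_weight b eta k).

Lemma charlier_seriesP (R : realType) (b eta a : R) (p q : {poly R}) :
  charlier_series b eta (a *: p + q)
  = a *: charlier_series b eta p + charlier_series b eta q.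
Proof.
rewrite /charlier_series -seriesZ -seriesD; congr (series _).
by apply/funext => k; rewrite /= hornerD hornerZ mulrDl -mulrA.
Qed.

(** Exact already for partial sums: the factor X kills the term k = 0, and reindexing the others
    costs one term, hence [n.+1] against [n]. *)
Lemma charlier_series_pearson (R : realType) (b eta : R) (p : {poly R}) (n : nat) :
  -1 < b ->
  charlier_series b eta ('X * ('X + b%:P) * p) n.+1
  = eta * charlier_series b eta (p \Po ('X + 1%:P)) n.
Proof.
move=> hb; rewrite /charlier_series /series /= big_nat_recl //= mulr_sumr.
rewrite !hornerM hornerX !mul0r add0r; apply: eq_bigr => k _.
rewrite horner_comp !hornerM !hornerD !hornerX !hornerC.
by rewrite natr1 [RHS]mulrCA -charlier_weightS // mulrAC mulrC.
Qed.

Lemma nonzero_at_nat (R : numDomainType) (p : {poly R}) :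
  p != 0 -> exists k : nat, p.[k%:R] != 0.
Proof.
move=> p_neq0; apply: contrapT => /forallNP p_root.
suff : (size [seq k%:R : R | k <- iota 0 (size p)] < size p)%N.
  by rewrite size_map size_iota ltnn.
apply: max_poly_roots => //.
  by apply/allP => _ /mapP[k _ ->]; apply/negPn/negP/p_root.
by rewrite map_inj_uniq ?iota_uniq // => i j /eqP; rewrite eqr_nat => /eqP.
Qed.

(** All the analysis is confined here; what follows is algebra with [L]. Convergence for every
    polynomial comes from the orthogonality series, since the [P n] span. *)
Lemma charlier_functional (R : realType) (b eta : R) (P : nat -> {poly R}) :
  -1 < b -> 0 < eta -> generalized_charlier b eta P ->
  exists (L : {scalar {poly R}}) (H : nat -> R),
    [/\ forall n m, L (P n * P m) = if n == m then H n else 0,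
        forall n, H n != 0 &
        forall p, L ('X * ('X + b%:P) * p) = eta * L (p \Po ('X + 1%:P))].
Proof.
move=> hb heta [hP [H hH]].
have P0 : P 0%N = 1.
  have [/monicP Pm Ps] := hP 0%N; move: Pm; rewrite lead_coefE Ps /= => Pm.
  by rewrite [P 0%N]size1_polyC ?Ps // Pm.
have PPcvg n m : charlier_series b eta (P n * P m) @ \oo -->
    (if n == m then H n else 0).
  rewrite /charlier_series; under eq_fun do rewrite hornerM.
  exact: hH.
have pcvg p : cvgn (charlier_series b eta p).
  apply: (monic_span_ind (K := fun p => cvgn (charlier_series b eta p))
    (m := size p) hP) => //.
  - rewrite (_ : charlier_series b eta 0 = cst 0); first exact: is_cvg_cst.
    apply/funext => n; rewrite /charlier_series /series /= big1 // => k _.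
    by rewrite horner0 mul0r.
  - move=> a q r cq cr; rewrite charlier_seriesP; apply: is_cvgD => //.
    exact: is_cvgZr.
  (* As P_0 = 1, the series of [P i] is the orthogonality series of the pair (i, 0). *)
  - move=> i _; rewrite -[P i]mulr1 -P0; apply/cvg_ex; eexists; exact: PPcvg.
pose L p := limn (charlier_series b eta p).
have Llin : linear_for *%R L.
  move=> a p q; rewrite /L charlier_seriesP limD; first by rewrite limZr.
    exact: is_cvgZr.
  exact: pcvg.
pose L' : {scalar {poly R}} := HB.pack L (GRing.isLinear.Build _ _ _ _ L Llin).
exists L', H; split => [n m|n|p].
- exact: cvg_lim (PPcvg n m).
- have [k Pk] : exists k : nat, (P n).[k%:R] != 0.
    by apply: nonzero_at_nat; apply: monic_neq0; case: (hP n).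
  have nd : nondecreasing_seq (charlier_series b eta (P n * P n)).
    apply: nondecreasing_series => i _ _; rewrite hornerM mulr_ge0 ?sqr_ge0 //.
    exact: ltW (charlier_weight_gt0 _ hb heta).
  (* H_n dominates the partial sum up to and including k, whose terms are nonnegative and whose last
     term is positive. *)
  have := nondecreasing_cvgn_le nd (pcvg _) k.+1.
  have := PPcvg n n; rewrite eqxx => /cvg_lim -> // hle.
  apply: lt0r_neq0; apply: lt_le_trans hle.
  rewrite /charlier_series /series /= big_nat_recr //= ltr_wpDl //.
    apply: sumr_ge0 => i _; rewrite hornerM mulr_ge0 -?expr2 ?sqr_ge0 //.
    exact: ltW (charlier_weight_gt0 _ hb heta).
  rewrite hornerM mulr_gt0 ?charlier_weight_gt0 // -expr2 lt0r sqrf_eq0 Pk.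
  exact: sqr_ge0.
- rewrite /= /L; apply: cvg_lim => //; rewrite -cvg_shiftS.
  under eq_fun do rewrite charlier_series_pearson //.
  apply: cvgMr; exact: pcvg.
Qed.

(** * Algebra of an orthogonality functional with a Pearson equation, over a field *)

Section LaguerreFreud.
Context (R : fieldType) (b eta : R) (P : nat -> {poly R}) (beta gamma H : nat -> R).
Context (L : {scalar {poly R}}).
Hypothesis eta_neq0 : eta != 0.
Hypothesis P_monic : forall n, P n \is monic /\ size (P n) = n.+1.
Hypothesis L_ortho : forall n m, L (P n * P m) = if n == m then H n else 0.
Hypothesis H_neq0 : forall n, H n != 0.
Hypothesis L_pearson : forall p,
  L ('X * ('X + b%:P) * p) = eta * L (p \Po ('X + 1%:P)).
Hypothesis gamma0 : gamma 0%N = 0.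
Hypothesis recurrence : forall n,
  'X * P n = P n.+1 + beta n *: P n + gamma n *: term_before P n.

Lemma functional_lt (n : nat) (q : {poly R}) : (size q <= n)%N -> L (P n * q) = 0.
Proof.
apply: (monic_span_ind (K := fun q => L (P n * q) = 0) P_monic) => [|a p r Lp Lr|i].
- by rewrite mulr0 raddf0.
- by rewrite mulrDr -scalerAr linearP Lp Lr mulr0 addr0.
- by rewrite L_ortho; case: eqP => // ->; rewrite ltnn.
Qed.

Lemma functional_X_diag (n : nat) : L ('X * P n * P n) = beta n * H n.
Proof.
rewrite recurrence !mulrDl -!scalerAl !linearD !linearZ /= !L_ortho eqxx.
rewrite gtn_eqF // add0r; case: n => [|n] /=.
  by rewrite gamma0 mul0r addr0.
by rewrite L_ortho ltn_eqF // mulr0 addr0.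
Qed.

Lemma functional_X_succ (n : nat) : L ('X * P n.+1 * P n) = H n.+1.
Proof.
rewrite -mulrA (mulrC (P n.+1)) mulrA recurrence !mulrDl -!scalerAl !linearD !linearZ /=.
rewrite !L_ortho eqxx ltn_eqF // mulr0 addr0; case: n => [|n] /=.
  by rewrite gamma0 mul0r addr0.
by rewrite L_ortho ltn_eqF ?mulr0 ?addr0 // ltnW.
Qed.

(** L(X P_{n+1} P_n) is computed twice, applying the recurrence to P_n and then to P_{n+1}. *)
Lemma normS (n : nat) : H n.+1 = gamma n.+1 * H n.
Proof.
rewrite -functional_X_succ recurrence !mulrDl -!scalerAl !linearD !linearZ /=.
by rewrite !L_ortho eqxx !gtn_eqF ?mulr0 ?add0r // ltnW.
Qed.

Lemma gamma_neq0 (n : nat) : gamma n.+1 != 0.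
Proof. by apply: contra_neq (H_neq0 n.+1) => g0; rewrite normS g0 mul0r. Qed.

Lemma functional_X_lt (n : nat) (q : {poly R}) : (size q < n)%N ->
  L ('X * P n * q) = 0.
Proof.
move=> sq; rewrite mulrAC mulrC; apply: functional_lt.
by apply: leq_trans (size_polyMleq _ _) _; rewrite size_polyX.
Qed.

(** * Pairings against theta = X (X + b) *)

Lemma functional_XX_succ (n : nat) :
  L ('X * P n.+1 * ('X * P n)) = H n.+1 * (beta n.+1 + beta n).
Proof.
rewrite [in X in _ * X]recurrence.
rewrite !mulrDr -!scalerAr !linearD !linearZ /= functional_X_diag functional_X_succ.
case: n => [|n] /=; first by rewrite gamma0; ring.
rewrite functional_X_lt; last by have [_ ->] := P_monic n.
ring.
Qed.

Lemma functional_theta_diag (n : nat) :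
  L ('X * ('X + b%:P) * (P n * P n))
  = H n * (gamma n.+1 + gamma n + beta n ^+ 2 + b * beta n).
Proof.
have -> : 'X * ('X + b%:P) * (P n * P n)
    = ('X * P n) * ('X * P n) + b *: ('X * P n * P n) by rewrite -mul_polyC; ring.
rewrite linearD linearZ /= functional_X_diag [in X in _ * X]recurrence.
rewrite !mulrDr -!scalerAr !linearD !linearZ /= functional_X_diag.
have -> : L ('X * P n * P n.+1) = H n.+1.
  by rewrite -functional_X_succ mulrAC.
case: n => [|n] /=; first by rewrite gamma0 normS; ring.
rewrite functional_X_succ !normS; ring.
Qed.

Lemma functional_theta_succ (n : nat) :
  L ('X * ('X + b%:P) * (P n.+1 * P n)) = H n.+1 * (beta n.+1 + beta n + b).
Proof.
have -> : 'X * ('X + b%:P) * (P n.+1 * P n)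
    = 'X * P n.+1 * ('X * P n) + b *: ('X * P n.+1 * P n) by rewrite -mul_polyC; ring.
rewrite linearD linearZ /= functional_XX_succ functional_X_succ; ring.
Qed.

Lemma functional_theta_succ2 (n : nat) :
  L ('X * ('X + b%:P) * (P n.+2 * P n)) = H n.+2.
Proof.
have -> : 'X * ('X + b%:P) * (P n.+2 * P n)
    = 'X * P n.+2 * ('X * P n) + b *: ('X * P n.+2 * P n) by rewrite -mul_polyC; ring.
have Ps m : size (P m) = m.+1 by have [] := P_monic m.
rewrite linearD linearZ /= (recurrence n) !mulrDr -!scalerAr !linearD !linearZ /=.
rewrite functional_X_succ !(@functional_X_lt n.+2) ?Ps //; first by ring.
by case: n => [|n] /=; rewrite ?size_poly0 ?Ps // !ltnS ltnW.
Qed.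

Lemma functional_theta_lt (n : nat) (q : {poly R}) : (size q <= n.-2)%N ->
  L ('X * ('X + b%:P) * (P n * q)) = 0.
Proof.
move=> sq; rewrite mulrCA; apply: functional_lt.
(* For n < 2 the truncated bound forces q = 0. *)
case: n sq => [|[|n]] /=;
  try by rewrite leqn0 size_poly_eq0 => /eqP ->; rewrite mulr0 size_poly0.
move=> sq; rewrite -mulrA.
apply: leq_trans (size_polyMleq _ _) _; rewrite size_polyX /= ltnS.
by apply: leq_trans (size_polyMleq _ _) _; rewrite size_XaddC.
Qed.

(** The coefficient of P_{n-2} in P_n(X+s). Both s = 1 and s = -1 occur, on the two sides of the
    Pearson identity. *)
Let shift_coef (s : R) (n : nat) : R := s ^+ 2 * 'C(n, 2)%:R
  + s * (n.-1%:R * (P n)`_n.-1 - n%:R * (P n.-1)`_n.-2).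

Lemma shift_expansion (s : R) (n : nat) : exists2 r : {poly R}, (size r <= n.-2)%N &
  P n \Po ('X + s%:P)
  = P n + (s * n%:R) *: term_before P n
    + shift_coef s n *: term_before (term_before P) n + r.
Proof.
exists (P n \Po ('X + s%:P) - (P n + (s * n%:R) *: term_before P n
    + shift_coef s n *: term_before (term_before P) n)).
  exact: size_shift_expansion.
by rewrite subrKC.
Qed.

(** In [L_pearson] the shift by 1 undoes the shift by -1 on P_m and so falls on P_n alone. *)
Lemma pearson_adjoint (n m : nat) :
  L ('X * ('X + b%:P) * (P n * (P m \Po ('X + (-1)%:P))))
  = eta * L (P m * (P n \Po ('X + 1%:P))).
Proof.
rewrite L_pearson comp_polyM -comp_polyA comp_polyD comp_polyX comp_polyC.
by rewrite -addrA -polyCD subrr addr0 comp_polyXr [P m * _]mulrC.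
Qed.

(** * Pairings of shifted polynomials *)

Lemma size_term_before (n : nat) : (size (term_before P n) <= n)%N.
Proof. by case: n => [|n] /=; rewrite ?size_poly0 //; have [_ ->] := P_monic n. Qed.

Lemma size_term_before2 (n : nat) :
  (size (term_before (term_before P) n) <= n.-1)%N.
Proof. by case: n => [|n] /=; rewrite ?size_poly0 ?size_term_before. Qed.

Lemma shift_pair_diag (n : nat) : L (P n * (P n \Po ('X + 1%:P))) = H n.
Proof.
have [r sr ->] := shift_expansion 1 n.
rewrite !mulrDr -!scalerAr !linearD !linearZ /= L_ortho eqxx.
rewrite !functional_lt ?mulr0 ?addr0 ?size_term_before //.
by apply: leq_trans (size_term_before2 n) _; rewrite -subn1 leq_subr.
  by apply: leq_trans sr _; rewrite -subn2 leq_subr.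
Qed.

Lemma shift_pair_succ (n : nat) :
  L (P n * (P n.+1 \Po ('X + 1%:P))) = n.+1%:R * H n.
Proof.
have [r /= sr ->] := shift_expansion 1 n.+1.
rewrite !mulrDr -!scalerAr !linearD !linearZ /= !L_ortho eqxx ltn_eqF //.
rewrite !functional_lt ?size_term_before //; first by ring.
by apply: leq_trans sr _; rewrite -subn1 leq_subr.
Qed.

Lemma shift_pair_succ2 (n : nat) :
  L (P n * (P n.+2 \Po ('X + 1%:P))) = shift_coef 1 n.+2 * H n.
Proof.
have [r /= sr ->] := shift_expansion 1 n.+2.
rewrite !mulrDr -!scalerAr !linearD !linearZ /= !L_ortho eqxx.
rewrite !ltn_eqF ?functional_lt // ?ltnW //; ring.
Qed.

Lemma functional_theta_shift (s : R) (m n : nat) : (m <= n)%N ->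
  L ('X * ('X + b%:P) * (P n * (P m \Po ('X + s%:P))))
  = L ('X * ('X + b%:P) * (P n * P m))
    + s * m%:R * L ('X * ('X + b%:P) * (P n * term_before P m))
    + shift_coef s m * L ('X * ('X + b%:P) * (P n * term_before (term_before P) m)).
Proof.
move=> mn; have [r sr ->] := shift_expansion s m.
set theta := 'X * ('X + _).
rewrite !mulrDr -!scalerAr !linearD !linearZ /= [L (theta * (P n * r))]functional_theta_lt.
  by rewrite addr0.
by apply: leq_trans sr _; rewrite -!subn2 leq_sub2r.
Qed.

Lemma shift_coefE (n : nat) : shift_coef 1 n.+2 = gamma n.+2 * gamma n.+1 / eta.
Proof.
have := pearson_adjoint n.+2 n; rewrite shift_pair_succ2.
rewrite functional_theta_shift; last exact: leqW.
rewrite functional_theta_succ2 !(functional_theta_lt (n := n.+2)) ?size_term_before //;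
  last by apply: leq_trans (size_term_before2 n) _; rewrite -subn1 leq_subr.
rewrite !mulr0 !addr0 !normS => eq_d.
apply: (mulIf (H_neq0 n)); apply: (mulfI eta_neq0); rewrite -eq_d.
by field.
Qed.

(** * The Laguerre--Freud relations and the subleading coefficient *)

Lemma binom2E (n : nat) : 'C(n.+2, 2)%:R * 2 = n.+2%:R * n.+1%:R :> R.
Proof. by rewrite -!natrM (bin_ffact n.+2 2) !ffactSS ffactn0 muln1. Qed.

(** The factor n+1 comes from shifting P_{n+1} by 1, the summand n from shifting P_n by -1; the
    identity is then divided by H_{n+1} = gamma_{n+1} H_n. *)
Lemma beta_relation (n : nat) :
  beta n.+1 = eta * n.+1%:R / gamma n.+1 - beta n + n%:R - b.
Proof.
have := pearson_adjoint n.+1 n; rewrite shift_pair_succ.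
rewrite functional_theta_shift // functional_theta_succ.
rewrite (functional_theta_lt (q := term_before (term_before P) n)) ?size_term_before2 //.
have -> : -1 * n%:R * L ('X * ('X + b%:P) * (P n.+1 * term_before P n))
          = - n%:R * H n.+1.
  case: n => [|n] /=; first by rewrite !(mulr0, oppr0, mul0r).
  by rewrite functional_theta_succ2 mulN1r.
rewrite !normS => eq_n; have gn := gamma_neq0 n; have Hn := H_neq0 n.
suff -> : eta * n.+1%:R / gamma n.+1 = beta n.+1 + beta n + b - n%:R by ring.
apply: (mulIf Hn); apply: (mulfI gn).
transitivity (eta * (n.+1%:R * H n)); first by field.
by rewrite -eq_n; ring.
Qed.

(** The middle term -n (beta_n + beta_{n-1} + b) H_n is rewritten by [beta_relation] as -n (eta n /
    gamma_n + n - 1) H_n; its part -n (n-1) H_n cancels against [shift_coef (-1) n]. *)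
Lemma gamma_relation (n : nat) :
  gamma n.+1 = eta - gamma n - beta n ^+ 2 - b * beta n
    + term_before gamma n * gamma n / eta
    + (if n == 0%N then 0 else eta * n%:R ^+ 2 / gamma n).
Proof.
have := pearson_adjoint n n; rewrite shift_pair_diag.
rewrite functional_theta_shift // functional_theta_diag.
have Hn := H_neq0 n; move=> eqH.
suff : eta = gamma n.+1 + gamma n + beta n ^+ 2 + b * beta n
    - term_before gamma n * gamma n / eta
    - (if n == 0%N then 0 else eta * n%:R ^+ 2 / gamma n) by move=> {1}->; ring.
apply: (mulIf Hn); rewrite -{}eqH.
case: n Hn => [|[|n]] Hn /=.
- rewrite gamma0 !mulr0 linear0; ring.
- rewrite !mulr0 linear0 functional_theta_succ (beta_relation 0) gamma0.
  have g1 := gamma_neq0 0; field. by rewrite eta_neq0 g1.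
rewrite functional_theta_succ functional_theta_succ2.
(* The part of [shift_coef] linear in s cancels in the sum over s = 1 and s = -1, leaving twice the
   binomial coefficient. *)
have -> : shift_coef (-1) n.+2
    = n.+2%:R * n.+1%:R - gamma n.+2 * gamma n.+1 / eta.
  by rewrite -shift_coefE /shift_coef /= -binom2E; ring.
have g2 := gamma_neq0 n.+1; rewrite (beta_relation n.+1); field.
by rewrite eta_neq0 g2.
Qed.

(** The subleading coefficients of P_n and P_{n+1} satisfy two linear equations, one from the
    recurrence and one from [shift_coefE]; the one of P_{n+1} is eliminated. *)
Lemma subleading_coefficient (n : nat) : 2 != 0 :> R -> (0 < n)%N ->
  (P n)`_n.-1 = n%:R * (n%:R + 1) / 2%:R - n%:R * beta n
                - gamma n * gamma n.+1 / eta.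
Proof.
move=> two_neq0; case: n => // n _ /=.
have Plead m : (P m)`_m = 1.
  by have [/monicP + sm] := P_monic m; rewrite lead_coefE sm.
(* In this degree the recurrence says that the subleading coefficients of P_{n+1} and P_{n+2} differ
   by beta_{n+1}. *)
have := congr1 (fun p : {poly R} => p`_n.+1) (recurrence n.+1).
rewrite /= coefXM /= !coefD !coefZ Plead mulr1.
rewrite [(P n)`_n.+1]nth_default ?mulr0 ?addr0; last by have [_ ->] := P_monic n.
move=> Pn.
have := shift_coefE n; rewrite /shift_coef /= Pn => eq_c.
have -> : gamma n.+1 * gamma n.+2 / eta = gamma n.+2 * gamma n.+1 / eta by ring.
rewrite -eq_c; apply: (mulIf two_neq0).
have bE := binom2E n.
have -> : 'C(n.+2, 2)%:R = n.+2%:R * n.+1%:R / 2 :> R by rewrite -bE mulfK.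
by field.
Qed.

End LaguerreFreud.

Theorem proposition12 (R : realType) (b eta : R) (hb : -1 < b) (heta : 0 < eta)
    (P : nat -> {poly R}) (hP : generalized_charlier b eta P)
    (beta gamma : nat -> R) (hrec : recursion_coefficients P beta gamma) :
  (forall n : nat,
     beta n.+1 = eta * n.+1%:R / gamma n.+1 - beta n + n%:R - b) /\
  (forall n : nat,
     gamma n.+1 = eta - gamma n - beta n ^+ 2 - b * beta n
                  + term_before gamma n * gamma n / eta
                  + (if n == 0%N then 0 else eta * n%:R ^+ 2 / gamma n)) /\
  (forall n : nat, (0 < n)%N ->
     (P n)`_n.-1 = n%:R * (n%:R + 1) / 2%:R - n%:R * beta n
                   - gamma n * gamma n.+1 / eta).
Proof.
have [L [H [ortho H_neq0 pearson]]] := charlier_functional hb heta hP.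
have [P_monic _] := hP; have [gamma0 recurrence] := hrec.
have eta_neq0 := lt0r_neq0 heta.
split; last split.
- exact: beta_relation P_monic ortho H_neq0 pearson gamma0 recurrence.
- exact: gamma_relation eta_neq0 P_monic ortho H_neq0 pearson gamma0 recurrence.
- move=> n; apply: (subleading_coefficient eta_neq0 P_monic ortho H_neq0 pearson
    gamma0 recurrence).
  by rewrite pnatr_eq0.
Qed.
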